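(* If $\overline{R[It]}=R_s(I)$ and $K[Ft]=A(P)$, then $R[It]$ is normal.
   Context: Let $R=K[x_1,\ldots,x_n]$ be a polynomial ring over a field $K$, write $x^a=x_1^{a_1}\cdots x_n^{a_n}$, and let $I\subset R$ be an ideal of height $g\ge 2$ minimally generated by a finite set $F=\{x^{v_1},\ldots,x^{v_q}\}$ of square-free monomials of degree at least two. Each variable $x_i$ divides at least one monomial of $F$. The Rees algebra of $I$ is $R[It]=R\oplus It\oplus I^2t^2\oplus\cdots\subset R[t]$, $t$ a new variable; $\overline{R[It]}$ is its integral closure in its field of fractions, and $R[It]$ is normal if $R[It]=\overline{R[It]}$. Let $\mathfrak p_1,\ldots,\mathfrak p_s$ be the minimal primes of $I$; the $i$th symbolic power of $I$ is $I^{(i)}=\mathfrak p_1^i\cap\cdots\cap\mathfrak p_s^i$, and the symbolic Rees algebra is $R_s(I)=R+I^{(1)}t+I^{(2)}t^2+\cdots\subset R[t]$. Let $P=\mathrm{conv}(v_1,\ldots,v_q)\subset\mathbb R^n$. The Ehrhart ring of $P$ is $A(P)=K[\{x^at^i\mid a\in\mathbb Z^n\cap iP,\ i\in\mathbb N\}]\subset R[t]$, and $K[Ft]=K[x^{v_1}t,\ldots,x^{v_q}t]\subset R[t]$. *)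

(* Defs.v *)
From HB Require Import structures.
From mathcomp Require Export all_boot all_order all_algebra.
From mathcomp Require Export boolp classical_sets reals.
From mathcomp Require Export mpoly fraction.

Set Implicit Arguments.
Unset Strict Implicit.
Unset Printing Implicit Defensive.

Import Order.TTheory GRing.Theory Num.Theory.

Local Open Scope classical_set_scope.
Local Open Scope ring_scope.

Definition is_ideal (R : comNzRingType) (J : set R) : Prop :=
  [/\ J 0, (forall x y, J x -> J y -> J (x + y))
    & forall a x, J x -> J (a * x)].

Definition ideal_gen (R : comNzRingType) (G : set R) : set R :=
  smallest (@is_ideal R) G.

Definition minimally_generates (R : comNzRingType) (G J : set R) : Prop :=
  ideal_gen G = J /\ forall H : set R, H `<` G -> ideal_gen H <> J.

Definition ideal_mul (R : comNzRingType) (J1 J2 : set R) : set R :=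
  ideal_gen [set x * y | x in J1 & y in J2].

Fixpoint ideal_exp (R : comNzRingType) (J : set R) (i : nat) : set R :=
  if i is j.+1 then ideal_mul J (ideal_exp J j) else setT.

(* [idealr_closed] already contains the requirement that 1 is not in P. *)
Definition prime_ideal (R : comNzRingType) (P : set R) : Prop :=
  idealr_closed (mem P) /\ prime_idealr_closed (mem P).

Definition prime_chain (R : comNzRingType) (h : nat) (P : set R) : Prop :=
  exists c : nat -> set R,
    [/\ forall i, (i <= h)%N -> prime_ideal (c i),
        forall i, (i < h)%N -> c i `<` c i.+1
      & c h = P].

Definition prime_height (R : comNzRingType) (P : set R) (h : nat) : Prop :=
  prime_chain h P /\ forall k, prime_chain k P -> (k <= h)%N.

(* A prime without a [prime_height] has infinite height, hence puts no
   constraint on the minimum. *)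
Definition ideal_height (R : comNzRingType) (J : set R) (g : nat) : Prop :=
  (exists P, [/\ prime_ideal P, J `<=` P & prime_height P g]) /\
  (forall P h, prime_ideal P -> J `<=` P -> prime_height P h -> (g <= h)%N).

Definition minimal_prime (R : comNzRingType) (J P : set R) : Prop :=
  [/\ prime_ideal P, J `<=` P
    & forall Q, prime_ideal Q -> J `<=` Q -> Q `<=` P -> Q = P].

Definition symbolic_power (R : comNzRingType) (J : set R) (i : nat) : set R :=
  \bigcap_(P in [set P | minimal_prime J P]) ideal_exp P i.

Definition rees_algebra (R : comNzRingType) (J : set R) : set {poly R} :=
  [set f | forall i, ideal_exp J i f`_i].

Definition symbolic_rees_algebra (R : comNzRingType) (J : set R) :
    set {poly R} :=
  [set f | forall i, symbolic_power J i f`_i].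

(* For a subring A of a domain S, the field of fractions of A is realised
   inside that of S. *)
Definition frac_field (S : idomainType) (A : set S) : set {fraction S} :=
  [set z | exists a b, [/\ A a, A b, b != 0 & z = tofrac a / tofrac b]].

Definition integral_over (S : idomainType) (A : set S) (z : {fraction S}) :
    Prop :=
  exists p : {poly S},
    [/\ p \is monic, p \is a polyOver (mem A)
      & root (map_poly (@tofrac S) p) z].

Definition integral_closure (S : idomainType) (A : set S) :
    set {fraction S} :=
  [set z | frac_field A z /\ integral_over A z].

Definition normal_subring (S : idomainType) (A : set S) : Prop :=
  [set tofrac f | f in A] = integral_closure A.

Definition kalg_gen (K : fieldType) (n : nat)
    (G : set {poly {mpoly K[n]}}) : set {poly {mpoly K[n]}} :=
  smallest [set B : set {poly {mpoly K[n]}} |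
    subring_closed (mem B) /\ forall c : K, B (c%:MP)%:P] G.

Definition monom_pt (RR : realType) (n : nat) (m : 'X_{1..n}) : 'rV[RR]_n :=
  \row_j (m j)%:R.

Definition conv_hull (RR : realType) (n q : nat) (w : 'I_q -> 'rV[RR]_n) :
    set 'rV[RR]_n :=
  [set y | exists lam : 'I_q -> RR,
    [/\ forall k, 0 <= lam k, \sum_k lam k = 1
      & y = \sum_k lam k *: w k]].

(* The exponents of the generators x^a t^i range over the lattice points of
   iP with nonnegative coordinates; when P is a convex hull of exponent
   vectors, these are all the lattice points of iP. *)
Definition ehrhart_ring (K : fieldType) (RR : realType) (n : nat)
    (P : set 'rV[RR]_n) : set {poly {mpoly K[n]}} :=
  kalg_gen [set f | exists (a : 'X_{1..n}) (i : nat),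
    [set i%:R *: y | y in P] (monom_pt RR a) /\ f = 'X_[K, a] *: 'X^i].

Arguments ehrhart_ring K {RR n} P.

Definition monomial_subring (K : fieldType) (n q : nat)
    (v : 'I_q -> 'X_{1..n}) : set {poly {mpoly K[n]}} :=
  kalg_gen [set 'X_[K, v k] *: 'X | k in [set: 'I_q]].

Arguments monomial_subring K {n q} v.

(* Main.v *)
Require Import Defs.
From mathcomp Require Import ring.

Set Implicit Arguments.
Unset Strict Implicit.
Unset Printing Implicit Defensive.

(** The theorem rests on the following observation about exponents.
    All ideals in sight ([I], its minimal primes, and their powers) are
    monomial, so R[It] and R_s(I) are spanned by the monomials x^a t^b they
    contain.  Since every element of the integral closure lies in R_s(I), it
    suffices to show that x^a in I^(b) implies x^a in I^b.

    If x^a in I^(b) can be divided by a variable of its support without leaving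
    I^(b), induction on the degree of a concludes.  Otherwise every variable
    x_j dividing x^a lies in some minimal prime p of I with deg_p(a) = b, where
    deg_p counts the variables of p in a monomial with multiplicity: p is
    generated by variables, so membership in p^b means deg_p >= b.  Now x^a t^b
    is integral over R[It]; reading off the appropriate multidegree in an
    integral equation gives an r > 0 with x^(ra) in I^(rb), say
    ra = v_(k_1) + ... + v_(k_(rb)) + d with d >= 0.  If x_j divides x^d, take
    p as above: each generator of I lies in p, hence
    rb = deg_p(ra) >= rb + deg_p(d) > rb, which is absurd.  Therefore d = 0 and
    for b > 0 the point a/b is a convex combination of v_1, ..., v_q, i.e.
    x^a t^b is in A(P) = K[Ft], which is contained in R[It]; the case b = 0 is
    trivial.

    The two pillars are [symbolic_powerP], the description of I^(b) by the
    degrees deg_p, and [rees_integral_monomial], the extraction of r. *)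

Import Order.TTheory GRing.Theory Num.Theory.
Local Open Scope classical_set_scope.
Local Open Scope ring_scope.

(** * Monomial ideals *)

Definition monomial_ideal (K : fieldType) (n : nat) (S : set 'X_{1..n}) :
    set {mpoly K[n]} :=
  [set f | forall m, m \in msupp f -> S m].
Arguments monomial_ideal K {n} S.

Definition up_closed (n : nat) (S : set 'X_{1..n}) : Prop :=
  forall m a, S m -> S (m + a)%MM.

Definition sumset (n : nat) (S T : set 'X_{1..n}) : set 'X_{1..n} :=
  [set m | exists a b, [/\ S a, T b & m = (a + b)%MM]].

Fixpoint sumset_pow (n : nat) (S : set 'X_{1..n}) (b : nat) : set 'X_{1..n} :=
  if b is c.+1 then sumset S (sumset_pow S c) else setT.

Section MonomialIdeals.
Variables (K : fieldType) (n : nat).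
Implicit Types (S T : set 'X_{1..n}) (J : set {mpoly K[n]}) (m : 'X_{1..n}).
Implicit Types C : pred 'I_n.

Lemma ideal_gen_is_ideal (R : comNzRingType) (G : set R) :
  is_ideal (ideal_gen G).
Proof.
split.
- by move=> J [[J0 _ _] _].
- move=> x y Gx Gy J JG; have [[_ JD _] _] := JG.
  by apply: JD; [apply: Gx | apply: Gy].
- by move=> a x Gx J JG; have [[_ _ JM] _] := JG; apply: JM; apply: Gx.
Qed.

Lemma sub_ideal_gen (R : comNzRingType) (G : set R) : G `<=` ideal_gen G.
Proof. by move=> x Gx J [_]; apply. Qed.

Lemma ideal_gen_min (R : comNzRingType) (G J : set R) :
  is_ideal J -> G `<=` J -> ideal_gen G `<=` J.
Proof. by move=> idJ GJ x; apply; split. Qed.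

Lemma ideal_sum (R : comNzRingType) (J : set R) (T : Type) (r : seq T)
    (p : pred T) (F : T -> R) :
  is_ideal J -> (forall i, p i -> J (F i)) -> J (\sum_(i <- r | p i) F i).
Proof. by move=> [J0 JD _] JF; elim/big_rec: _ => // i x /JF; apply: JD. Qed.

Lemma monomial_idealX S m : monomial_ideal K S 'X_[m] <-> S m.
Proof.
rewrite /monomial_ideal /=; split=> [|Sm m']; rewrite msuppX ?inE.
  by apply; rewrite inE.
by move=> /eqP->.
Qed.

Lemma monomial_ideal_is_ideal S : up_closed S -> is_ideal (monomial_ideal K S).
Proof.
move=> upS; split.
- by move=> m; rewrite msupp0.
- move=> x y Sx Sy m /msuppD_le; rewrite mem_cat => /orP[/Sx|/Sy] //.
- move=> a x Sx m /msuppM_le /allpairsP[[m1 m2] /= [_ /Sx Sm2 ->]].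
  by rewrite addmC; apply: upS.
Qed.

Lemma monomial_ideal_sub S J :
  is_ideal J -> (forall m, S m -> J 'X_[m]) -> monomial_ideal K S `<=` J.
Proof.
move=> idJ SJ f Sf; rewrite [f]mpolyE big_seq; apply: ideal_sum => // m /Sf Sm.
by rewrite -mul_mpolyC; have [_ _ JM] := idJ; apply/JM/SJ.
Qed.

Lemma ideal_X_leq J m m' :
  is_ideal J -> (m <= m')%MM -> J 'X_[m] -> J 'X_[m'].
Proof.
by move=> [_ _ JM] /submK <-; rewrite mpolyXD; apply: JM.
Qed.

Lemma sumset_up S T : up_closed S -> up_closed (sumset S T).
Proof.
move=> upS _ m [s [t [Ss Tt ->]]].
by exists (s + m)%MM, t; split; [apply: upS | | rewrite -!addmA (addmC t)].
Qed.

Lemma sumset_pow_up S b : up_closed S -> up_closed (sumset_pow S b).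
Proof. by case: b => // b upS; apply: sumset_up. Qed.

Lemma ideal_mul_monomial S T : up_closed S ->
  ideal_mul (monomial_ideal K S) (monomial_ideal K T) =
  monomial_ideal K (sumset S T).
Proof.
move=> upS; apply/seteqP; split.
  apply: ideal_gen_min.
    exact/monomial_ideal_is_ideal/sumset_up.
  move=> _ [x Sx [y Ty <-]] m /msuppM_le /allpairsP[[s t] /= [/Sx Ss /Ty Tt ->]].
  by exists s, t.
apply: monomial_ideal_sub; first exact: ideal_gen_is_ideal.
move=> _ [s [t [Ss Tt ->]]]; rewrite mpolyXD; apply: sub_ideal_gen.
exists 'X_[s]; first exact/monomial_idealX.
by exists 'X_[t] => //; exact/monomial_idealX.
Qed.

Lemma ideal_exp_monomial S b : up_closed S ->
  ideal_exp (monomial_ideal K S) b = monomial_ideal K (sumset_pow S b).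
Proof.
move=> upS; elim: b => [|b IHb] /=; first by apply/seteqP; split.
by rewrite IHb ideal_mul_monomial.
Qed.

Lemma sumset_powD S b c m m' : up_closed S ->
  sumset_pow S b m -> sumset_pow S c m' -> sumset_pow S (b + c)%N (m + m')%MM.
Proof.
move=> upS; elim: b m => [|b IHb] m /=.
  by rewrite add0n addmC => _; apply: sumset_pow_up.
move=> [s [t [Ss Tt ->]]] Sm'.
by exists s, (t + m')%MM; split=> //; [apply: IHb | rewrite addmA].
Qed.

(** * Primes generated by variables *)

Definition set_deg (C : pred 'I_n) (m : 'X_{1..n}) : nat :=
  (\sum_(j < n | C j) m j)%N.

Lemma set_degD C m m' :
  set_deg C (m + m')%MM = (set_deg C m + set_deg C m')%N.
Proof. by rewrite -big_split; apply: eq_bigr => j _; rewrite mnmDE. Qed.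

Lemma set_degMn C m r : set_deg C (m *+ r)%MM = (set_deg C m * r)%N.
Proof. by rewrite /set_deg big_distrl; apply: eq_bigr => j _; rewrite mulmnE. Qed.

Lemma set_deg_gt0P C m :
  reflect (exists2 j, C j & (0 < m j)%N) (0 < set_deg C m)%N.
Proof.
rewrite lt0n sum_nat_eq0 negb_forall; apply: (iffP existsP) => -[j].
  by rewrite negb_imply -lt0n => /andP[]; exists j.
by move=> Cj mj; exists j; rewrite negb_imply -lt0n Cj.
Qed.

Lemma set_deg0 C : set_deg C 0%MM = 0%N.
Proof. by apply: big1 => j _; rewrite mnm0E. Qed.

Lemma set_degU C j : C j -> set_deg C U_(j)%MM = 1%N.
Proof.
move=> Cj; rewrite /set_deg (bigD1 j) //= mnm1E eqxx big1 // => i /andP[_ ij].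
by rewrite mnm1E eq_sym (negPf ij).
Qed.

Lemma mnmU_sub m j : (0 < m j)%N -> (m - U_(j) + U_(j))%MM = m.
Proof. by move=> mj; apply: submK; rewrite lep1mP -lt0n. Qed.

Definition meets (C : pred 'I_n) : set 'X_{1..n} :=
  [set m | (0 < set_deg C m)%N].

Lemma meets_up C : up_closed (meets C).
Proof. by move=> m a; rewrite /meets /= set_degD addn_gt0 => ->. Qed.

Lemma sumset_pow_meets C b m :
  sumset_pow (meets C) b m <-> (b <= set_deg C m)%N.
Proof.
elim: b m => [|b IHb] m; split=> //=.
  by move=> [s [t [Cs /IHb Ct ->]]]; rewrite set_degD -add1n leq_add.
move=> bm; have /set_deg_gt0P[j Cj mj] : (0 < set_deg C m)%N by apply: leq_trans bm.
exists U_(j)%MM, (m - U_(j))%MM; split.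
- by rewrite /meets /= set_degU.
- by apply/IHb; rewrite -(mnmU_sub mj) set_degD set_degU // addn1 in bm.
- by rewrite addmC mnmU_sub.
Qed.

(** Let [free f] be the part of [f] free of the variables in [C]; it is
    congruent to [f] modulo the ideal.  If u v is in the ideal, so is
    [free u * free v], yet all terms of that product are free of [C].  Hence it
    is zero, and one of the factors is zero because polynomials over a field
    form a domain. *)
Lemma monomial_ideal_meets_prime C :
  prime_ideal (monomial_ideal K (meets C)).
Proof.
set P := monomial_ideal K (meets C).
have idP : is_ideal P := monomial_ideal_is_ideal (meets_up (C := C)).
have [P0 PD PM] := idP.
split.
  split; rewrite ?inE //.
    apply/negP; rewrite inE => /(_ 0%MM); rewrite msupp1 inE eqxx.
    by move=> /(_ isT) /set_deg_gt0P[j _]; rewrite mnm0E.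
  by move=> a u v; rewrite !inE => Pu Pv; apply: PD => //; apply: PM.
pose free f : {mpoly K[n]} :=
  \sum_(m <- msupp f | set_deg C m == 0%N) f@_m *: 'X_[m].
have PB f : P (f - free f).
  rewrite {1}[f]mpolyE (bigID (fun m => set_deg C m == 0%N)) /= addrAC subrr add0r.
  apply: ideal_sum => // m Cm; rewrite -mul_mpolyC; apply: PM.
  by apply/monomial_idealX; rewrite /meets /= lt0n.
have free_supp f m : m \in msupp (free f) -> set_deg C m = 0%N.
  rewrite /free => /msupp_sum_le /flattenP[s /mapP[m']].
  rewrite mem_filter => /andP[/eqP Cm' _] -> /msuppZ_le.
  by rewrite msuppX inE => /eqP ->.
move=> u v; rewrite inE => Puv.
have Pfree : P (free u * free v).
  have -> : free u * free v = u * v + (- v) * (u - free u)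
      + (- free u) * (v - free v).
    by ring.
  by apply: (PD); [apply: (PD) => // |]; apply: PM.
have : free u * free v = 0.
  apply/eqP; rewrite -msupp_eq0; case Es: (msupp _) => [//|m s].
  have min : m \in msupp (free u * free v) by rewrite Es inE eqxx.
  have := Pfree _ min; have /allpairsP[[m1 m2] /= [+ + ->]] := msuppM_le min.
  by rewrite /meets /= set_degD => /free_supp -> /free_supp ->.
move=> /eqP; rewrite mulf_eq0 => /orP[] /eqP f0; apply/orP; [left|right];
  by rewrite inE -[X in P X]subr0 -f0; apply: PB.
Qed.

Lemma prime_ideal_is_ideal (R : comNzRingType) (P : set R) :
  prime_ideal P -> is_ideal P.
Proof.
move=> [[P0 _ PM] _]; rewrite inE in P0; split=> //.
  by move=> x y Px Py; have := PM 1 x y; rewrite !inE mul1r; apply.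
by move=> a x Px; have := PM a x 0; rewrite !inE addr0; apply.
Qed.

Lemma prime_X_var (P : set {mpoly K[n]}) m :
  prime_ideal P -> P 'X_[m] -> exists2 j, P 'X_j & (0 < m j)%N.
Proof.
move=> [[_ P1 _] primeP]; move: {2}(mdeg m) (erefl (mdeg m)) => d.
elim: d m => [|d IHd] m dm.
  move/eqP: dm; rewrite mdeg_eq0 => /eqP ->; rewrite mpolyX0 => P1'.
  by case/negP: P1; rewrite inE.
have [j mj] : exists j, (0 < m j)%N.
  have : (0 < set_deg predT m)%N by rewrite /set_deg -mdegE dm.
  by move=> /set_deg_gt0P[j _]; exists j.
rewrite -(mnmU_sub mj) mpolyXD => Pm.
have := primeP _ _ (mem_set Pm) => /orP[]; rewrite inE => Pj; last first.
  by exists j; rewrite ?mnmU_sub.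
have [|i Pi mi] := IHd _ _ Pj.
  by move: dm; rewrite -{1}(mnmU_sub mj) mdegD mdeg1 addn1 => -[].
by exists i; rewrite // mnmDE addn_gt0 mi.
Qed.

Definition vars_in (P : set {mpoly K[n]}) : pred 'I_n :=
  fun j => `[< P 'X_j >].

End MonomialIdeals.

(** * Ordinary and symbolic powers of a monomial ideal *)

Definition multiples (n q : nat) (v : 'I_q -> 'X_{1..n}) : set 'X_{1..n} :=
  [set m | exists k, (v k <= m)%MM].

Section MonomialGenerators.
Variables (K : fieldType) (n q : nat) (v : 'I_q -> 'X_{1..n}).
Implicit Types (m : 'X_{1..n}) (P : set {mpoly K[n]}).

Lemma multiples_up : up_closed (multiples v).
Proof.
by move=> m a [k vm]; exists k; apply: lepm_trans vm _; apply: lem_addr.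
Qed.

Lemma ideal_gen_monomials :
  ideal_gen [set 'X_[K, v k] | k in [set: 'I_q]] =
  monomial_ideal K (multiples v).
Proof.
apply/seteqP; split.
  apply: ideal_gen_min; first exact: monomial_ideal_is_ideal multiples_up.
  by move=> _ [k _ <-]; apply/monomial_idealX; exists k; apply: lepm_refl.
apply: monomial_ideal_sub; first exact: ideal_gen_is_ideal.
move=> m [k vm]; apply: ideal_X_leq vm _; first exact: ideal_gen_is_ideal.
by apply: sub_ideal_gen; exists k.
Qed.

Lemma sumset_pow_multiples b m : sumset_pow (multiples v) b m ->
  exists (c : 'I_q -> nat) (d : 'X_{1..n}),
    (\sum_k c k)%N = b /\ m = ((\sum_k v k *+ c k) + d)%MM.
Proof.
elim: b m => [|b IHb] m /=.
  move=> _; exists (fun=> 0%N), m; split; first by rewrite big1.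
  by rewrite big1 ?add0m // => k _; rewrite mulm0n.
move=> [s [t [[k0 vs] /IHb[c [d [cb ->]]] ->]]].
exists (fun k => (k == k0) + c k)%N, ((s - v k0) + d)%MM; split.
  rewrite big_split /= cb (bigD1 k0) //= eqxx big1 ?addn0 //.
  by move=> k /negPf ->.
apply/mnmP=> j; rewrite !mnmDE !mnm_sumE mnmBE.
have vsj : (v k0 j <= s j)%N by apply/mnm_lepP.
have -> : (\sum_i (v i *+ ((i == k0) + c i))%MM j =
           v k0 j + \sum_i (v i *+ c i)%MM j)%N.
  rewrite (eq_bigr (fun i => v i j * (i == k0) + (v i *+ c i)%MM j))%N; last first.
    by move=> i _; rewrite !mulmnE mulnDr.
  rewrite big_split /= (bigD1 k0) //= eqxx muln1 big1 ?addn0 //.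
  by move=> k /negPf ->; rewrite muln0.
by rewrite addnACA subnKC // addnCA.
Qed.

(** The ideal generated by the variables of [P] is a prime between the
    monomial ideal and [P], so minimality forces it to be [P]. *)
Lemma minimal_prime_monomial P :
  minimal_prime (monomial_ideal K (multiples v)) P ->
  P = monomial_ideal K (meets (vars_in P)).
Proof.
move=> [prP IP minP]; have idP := prime_ideal_is_ideal prP.
apply/esym/minP; first exact: monomial_ideal_meets_prime.
- move=> f If m /If [k vm]; have /(prime_X_var prP)[j Pj vkj] : P 'X_[v k].
    by apply: IP; apply/monomial_idealX; exists k; apply: lepm_refl.
  apply/set_deg_gt0P; exists j; first exact/asboolP.
  by apply: leq_trans vkj _; apply/mnm_lepP.
- apply: monomial_ideal_sub => // m /set_deg_gt0P[j /asboolP Pj mj].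
  by apply: ideal_X_leq Pj => //; rewrite lep1mP -lt0n.
Qed.

(** Each minimal prime is generated by variables, so its powers are monomial
    and [set_deg] decides which monomials they contain. *)
Lemma symbolic_powerP b f :
  symbolic_power (monomial_ideal K (multiples v)) b f <->
  forall P, minimal_prime (monomial_ideal K (multiples v)) P ->
    forall m, m \in msupp f -> (b <= set_deg (vars_in P) m)%N.
Proof.
have expP P : minimal_prime (monomial_ideal K (multiples v)) P ->
    ideal_exp P b =
    monomial_ideal K (sumset_pow (meets (vars_in P)) b).
  move=> /minimal_prime_monomial {1}->.
  by rewrite ideal_exp_monomial //; apply: meets_up.
split=> [If P minP m mf|If P minP].
  by apply/sumset_pow_meets; have := If P minP; rewrite expP //; apply.
by rewrite expP // => m mf; apply/sumset_pow_meets; apply: If.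
Qed.

Lemma minimal_prime_gen_deg P k :
  minimal_prime (monomial_ideal K (multiples v)) P ->
  (0 < set_deg (vars_in P) (v k))%N.
Proof.
move=> [prP IP _]; have /(prime_X_var prP)[j Pj vkj] : P 'X_[v k].
  by apply: IP; apply/monomial_idealX; exists k; apply: lepm_refl.
by apply/set_deg_gt0P; exists j => //; apply/asboolP.
Qed.

End MonomialGenerators.

(** * The Rees algebra of a monomial ideal *)

Lemma rees_monomialP (K : fieldType) (n : nat) (S : set 'X_{1..n})
    (f : {poly {mpoly K[n]}}) : up_closed S ->
  rees_algebra (monomial_ideal K S) f <->
  forall i m, m \in msupp f`_i -> sumset_pow S i m.
Proof.
move=> upS; split=> Sf i.
  by have := Sf i; rewrite ideal_exp_monomial.
by rewrite ideal_exp_monomial // => m; apply: Sf.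
Qed.

Lemma rees_monomial_subring (K : fieldType) (n : nat) (S : set 'X_{1..n}) :
  up_closed S -> subring_closed (mem (rees_algebra (monomial_ideal K S))).
Proof.
move=> upS; split.
- rewrite inE; apply/rees_monomialP => // -[|i] m //.
  by rewrite coef1 msupp0.
- move=> f g; rewrite !inE => /rees_monomialP Sf /rees_monomialP Sg.
  apply/rees_monomialP => // i m; rewrite coefB.
  by move=> /msuppB_le; rewrite mem_cat => /orP[/Sf|/Sg]; apply.
- move=> f g; rewrite !inE => /rees_monomialP Sf /rees_monomialP Sg.
  apply/rees_monomialP => // i m; rewrite coefM.
  move=> /msupp_sum_le /flattenP[s /mapP[j _ ->]].
  move=> /msuppM_le /allpairsP[[a b] /= [/Sf Sa /Sg Sb ->]].
  rewrite -(subnKC (m := j) (n := i)) -1?ltnS //.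
  by apply: sumset_powD => //; [apply: Sa | apply: Sb].
Qed.

Lemma monomial_subring_rees (K : fieldType) (n q : nat)
    (v : 'I_q -> 'X_{1..n}) :
  monomial_subring K v `<=` rees_algebra (monomial_ideal K (multiples v)).
Proof.
move=> f; apply; split.
  split; first exact: rees_monomial_subring (multiples_up (v := v)).
  move=> c; apply/rees_monomialP; first exact: multiples_up.
  by move=> [|i] m //; rewrite coefC msupp0.
move=> _ [k _ <-]; apply/rees_monomialP; first exact: multiples_up.
move=> i m; rewrite coefZ coefX; case: eqP => [->|_]; last first.
  by rewrite mulr0 msupp0.
rewrite mulr1 msuppX inE => /eqP ->; exists (v k), 0%MM; split=> //.
  by exists k; apply: lepm_refl.
by rewrite addm0.
Qed.

(** Since [S] embeds into its fraction field, an integral equation for an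
    element of [S] already holds in [S], where coefficients can be compared. *)
Lemma integral_over_tofrac (S : idomainType) (A : set S) (f : S) :
  integral_over A (tofrac f) ->
  exists p : {poly S}, [/\ p \is monic, (forall i, (i < size p)%N -> A p`_i)
    & p.[f] = 0].
Proof.
move=> [p [mon_p Ap /rootP]]; rewrite horner_map => /eqP.
rewrite tofrac_eq0 => /eqP pf0; exists p; split=> // i ip.
by have /all_nthP /(_ _ ip) := Ap => /(_ 0); rewrite inE.
Qed.

(** An integral equation z^d + c_(d-1) z^(d-1) + ... = 0 for z = x^a t^b
    lives in the multigraded ring R[t]; in multidegree (d a, d b) the leading
    term must be cancelled by some c_(d-r) z^(d-r), so that c_(d-r), an element
    of R[It], contains x^(ra) t^(rb). *)
Lemma rees_integral_monomial (K : fieldType) (n : nat) (S : set 'X_{1..n})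
    (a : 'X_{1..n}) (b : nat) : up_closed S ->
  integral_over (rees_algebra (monomial_ideal K S))
    (tofrac ('X_[K, a] *: 'X^b)) ->
  exists2 r, (0 < r)%N & sumset_pow S (r * b) (a *+ r)%MM.
Proof.
move=> upS /integral_over_tofrac[p [mon_p Sp]].
case: (posnP (size p)) => [sp0|sp_gt0].
  by move: mon_p; rewrite monicE lead_coefE sp0 nth_default ?sp0 // eq_sym oner_eq0.
set z := 'X_[K, a] *: 'X^b; rewrite horner_coef => pz0.
set d := (size p).-1.
(* The coefficient of c z^i in the multidegree (d a, d b) of z^d. *)
have term (c : {poly {mpoly K[n]}}) i : (i <= d)%N ->
    (c * z ^+ i)`_(d * b)@_(a *+ d) = c`_((d - i) * b)@_(a *+ (d - i)).
  move=> id; rewrite /z exprZn -exprM mpolyXn -scalerAr coefZ coefMXn.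
  rewrite (mulnC b) ltn_mul2r [(d < i)%N]ltnNge id andbF -mulnBl.
  have -> : (a *+ d = a *+ i + a *+ (d - i))%MM.
    by apply/mnmP => j; rewrite mnmDE !mulmnE -mulnDr subnKC.
  by rewrite [_ * c`_ _]mulrC mcoeffMX.
have /existsP[i /andP[id]] :
    [exists i : 'I_(size p), (i < d)%N &&
       (p`_i`_((d - i) * b)@_(a *+ (d - i)) != 0)].
  apply: contraT; rewrite negb_exists => /forallP no_term.
  have dsz : (d < size p)%N by rewrite prednK.
  have := congr1 (fun f : {poly {mpoly K[n]}} => f`_(d * b)@_(a *+ d)) pz0.
  rewrite coef_sum raddf_sum /= (bigD1 (Ordinal dsz)) //= term // subnn.
  rewrite mulm0n -lead_coefE (monicP mon_p) coef1 mcoeff1 eqxx big1 ?addr0.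
    by rewrite coef0 mcoeff0 => /eqP; rewrite oner_eq0.
  move=> i ni; have id : (i < d)%N.
    rewrite ltn_neqAle -ltnS prednK // ltn_ord andbT.
    by apply: contra ni => /eqP ie; apply/eqP/val_inj.
  by rewrite term 1?ltnW //; have := no_term i; rewrite id /= negbK => /eqP.
rewrite -mcoeff_msupp => supp; exists (d - i)%N; first by rewrite subn_gt0.
by have /rees_monomialP := Sp i (ltn_ord i); apply.
Qed.

Lemma sub_integral_closure (S : idomainType) (A : set S) :
  subring_closed (mem A) ->
  [set tofrac f | f in A] `<=` integral_closure A.
Proof.
move=> ringA _ [f Af <-]; have [A1 AB _] := ringA.
have A0 : 0 \in mem A by rewrite -(subrr (1 : S)) AB.
split.
  exists f, 1; rewrite inE in A1.
  by split=> //; rewrite ?oner_eq0 // tofrac1 divr1.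
exists ('X - f%:P); split; first exact: monicXsubC.
  apply/(all_nthP 0) => i _; rewrite coefB coefX coefC.
  have Af' : f \in mem A by rewrite inE.
  by apply: AB; [case: (i == 1%N) | case: (i == 0%N)].
by rewrite rmorphB /= map_polyX map_polyC /= root_XsubC.
Qed.

(** * From integrality to the Ehrhart ring *)

Lemma ehrhart_monomial (RR : realType) (K : fieldType) (n q : nat)
    (v : 'I_q -> 'X_{1..n}) (a : 'X_{1..n}) (b r : nat) (c : 'I_q -> nat) :
  (0 < r)%N -> (0 < b)%N -> (\sum_k c k)%N = (r * b)%N ->
  (a *+ r)%MM = (\sum_k v k *+ c k)%MM ->
  ehrhart_ring K (conv_hull (fun k => monom_pt RR (v k))) ('X_[K, a] *: 'X^b).
Proof.
move=> r_gt0 b_gt0 csum arE B [_]; apply; exists a, b; split=> //.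
have r0 : r%:R != 0 :> RR by rewrite pnatr_eq0 -lt0n.
have b0 : b%:R != 0 :> RR by rewrite pnatr_eq0 -lt0n.
exists (b%:R^-1 *: monom_pt RR a); last by rewrite scalerA divff // scale1r.
exists (fun k => (c k)%:R / (r%:R * b%:R)); split.
- by move=> k; rewrite divr_ge0 // ?mulr_ge0 ?ler0n.
- by rewrite -mulr_suml -natr_sum csum natrM divff // mulf_neq0.
apply/rowP => j; rewrite summxE !mxE.
have := congr1 (fun m : 'X_{1..n} => (m j)%:R : RR) arE.
rewrite mnm_sumE mulmnE natrM natr_sum => arj.
rewrite -[(a j)%:R](mulfK r0) arj mulr_suml mulr_sumr; apply: eq_bigr => k _.
by rewrite !mxE mulmnE natrM; field; rewrite r0 b0.
Qed.

Theorem theorem4p1 (RR : realType) (K : fieldType) (n q g : nat)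
    (v : 'I_q -> 'X_{1..n}) (I : set {mpoly K[n]})
    (v_inj : injective v)
    (v_sqfree : forall k j, (v k j <= 1)%N)
    (v_deg : forall k, (2 <= mdeg (v k))%N)
    (v_vars : forall j, exists k, (0 < v k j)%N)
    (I_mingen : minimally_generates [set 'X_[K, v k] | k in [set: 'I_q]] I)
    (I_height : ideal_height I g)
    (g_ge2 : (2 <= g)%N) :
  integral_closure (rees_algebra I) =
    [set tofrac f | f in symbolic_rees_algebra I] ->
  monomial_subring K v =
    ehrhart_ring K (conv_hull (fun k => monom_pt RR (v k))) ->
  normal_subring (rees_algebra I).
Proof.
have [<- _] := I_mingen; rewrite ideal_gen_monomials.
set J := monomial_ideal K (multiples v) => closureE ehrhartE.
have upv := multiples_up (v := v).
suff power_eq b a : symbolic_power J b 'X_[a] -> sumset_pow (multiples v) b a.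
  apply/seteqP; split.
    exact/sub_integral_closure/rees_monomial_subring.
  rewrite closureE => _ [f Jf <-]; exists f => //.
  apply/rees_monomialP => // i a af; apply/power_eq/symbolic_powerP => P minP m.
  rewrite msuppX inE => /eqP ->.
  by have /symbolic_powerP := Jf i; apply.
have [->//|b_gt0] := posnP b.
have [d] := ubnP (mdeg a); elim: d a => // d IHd a ad /symbolic_powerP Ja.
have deg_ge P : minimal_prime J P -> (b <= set_deg (vars_in P) a)%N.
  by move=> minP; apply: Ja => //; rewrite msuppX inE.
(* Divide by variables as long as the quotient stays in the symbolic power. *)
have [[j [aj Jaj]]|irred] :=
    EM (exists j, (0 < a j)%N /\ symbolic_power J b 'X_[a - U_(j)]).
  rewrite -(mnmU_sub aj); apply: sumset_pow_up => //; apply: IHd => //.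
  by move: ad; rewrite -{1}(mnmU_sub aj) mdegD mdeg1 addn1 ltnS.
(* If x^(a - U_j) leaves the symbolic power, some minimal prime witnesses it;
   its degree must have dropped, so it contains x_j, and dropped below b, so it
   was exactly b. *)
have tight j : (0 < a j)%N -> exists P, [/\ minimal_prime J P,
    vars_in P j & set_deg (vars_in P) a = b].
  move=> aj; apply: contrapT => no_P; apply: irred; exists j; split=> //.
  apply/symbolic_powerP => P minP m; rewrite msuppX inE => /eqP ->.
  have := deg_ge P minP; have [Pj|Pj] := boolP (vars_in P j).
    rewrite leq_eqVlt => /orP[/eqP bE|]; first by case: no_P; exists P.
    by rewrite -{1}(mnmU_sub aj) set_degD set_degU // addn1 ltnS.
  rewrite -{1}(mnmU_sub aj) set_degD [set_deg _ U_(j)%MM]big1 ?addn0 //.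
  by move=> i Pi; rewrite mnm1E; case: eqP => // ji; rewrite ji Pi in Pj.
have [r r_gt0 /sumset_pow_multiples[c [e [csum arE]]]] :
    exists2 r, (0 < r)%N & sumset_pow (multiples v) (r * b) (a *+ r)%MM.
  apply: (@rees_integral_monomial K) => //.
  suff : integral_closure (rees_algebra J) (tofrac ('X_[K, a] *: 'X^b)).
    by case.
  rewrite closureE; exists ('X_[K, a] *: 'X^b) => // i.
  apply/symbolic_powerP => P minP m; rewrite coefZ coefXn.
  by case: eqP => [->|_]; [rewrite mulr1; apply: Ja | rewrite mulr0 msupp0].
(* Compare degrees with respect to a tight prime at x_j, should x_j divide x^e:
   the generators already contribute the whole of r b. *)
have e0 : e = 0%MM.
  apply/mnmP => j; rewrite mnm0E; apply/eqP; rewrite -leqn0 leqNgt.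
  apply/negP => ej.
  have aj : (0 < a j)%N.
    have := congr1 (fun m : 'X_{1..n} => m j) arE; rewrite mulmnE mnmDE => arj.
    have : (0 < a j * r)%N by rewrite arj addn_gt0 ej orbT.
    by rewrite muln_gt0 => /andP[].
  have [P [minP Pj Pa]] := tight j aj.
  have := congr1 (set_deg (vars_in P)) arE.
  rewrite set_degMn Pa set_degD => degE.
  have c_le : (\sum_k c k <= set_deg (vars_in P) (\sum_k v k *+ c k)%MM)%N.
    rewrite (big_morph _ (set_degD _) (set_deg0 _)); apply: leq_sum => k _.
    by rewrite set_degMn leq_pmull // minimal_prime_gen_deg.
  have e_gt0 : (0 < set_deg (vars_in P) e)%N by apply/set_deg_gt0P; exists j.
  have : (r * b < b * r)%N.
    by rewrite degE -csum -addn1 leq_add.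
  by rewrite mulnC ltnn.
rewrite e0 addm0 in arE.
have Iab : rees_algebra J ('X_[K, a] *: 'X^b).
  apply: monomial_subring_rees; rewrite ehrhartE.
  exact: ehrhart_monomial r_gt0 b_gt0 csum arE.
have /rees_monomialP /(_ b a) := Iab; apply=> //.
by rewrite coefZ coefXn eqxx mulr1 msuppX inE.
Qed.
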